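(* Let $X$ be a sequentially feebly compact topological space containing a dense set $D$ of isolated points (that is, $D$ is dense in $X$ and each point of $D$ is isolated in $X$). Then $X$ is sequentially pracompact.
   Context: No separation axioms are assumed. Let $X$ be a topological space. - $X$ is sequentially feebly compact if for each sequence $\{U_n : n\in\mathbb{N}\}$ of non-empty open subsets of $X$ there exist a point $x\in X$ and an infinite set $I\subset\mathbb{N}$ such that for each neighborhood $U$ of $x$ the set $\{n\in I : U_n\cap U=\varnothing\}$ is finite. - $X$ is sequentially pracompact if it contains a dense subset $D'$ such that each sequence of points of $D'$ has a subsequence converging to a point of $X$. *)

(* Defs.v *)
From mathcomp Require Import all_boot all_order all_classical.
From mathcomp Require Import topology sequences.

Set Implicit Arguments.
Unset Strict Implicit.
Unset Printing Implicit Defensive.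

Local Open Scope classical_set_scope.

Definition sequentially_feebly_compact (X : topologicalType) : Prop :=
  forall U : nat -> set X, (forall n, open (U n) /\ U n !=set0) ->
    exists (x : X) (I : set nat), infinite_set I /\
      forall V : set X, nbhs x V ->
        finite_set [set n | I n /\ U n `&` V = set0].

Definition sequentially_pracompact (X : topologicalType) : Prop :=
  exists D : set X, dense D /\
    forall u : nat -> X, (forall n, D (u n)) ->
      exists (f : nat -> nat) (x : X), increasing_seq f /\ u \o f @ \oo --> x.

(* Main.v *)
Require Import Defs.
From mathcomp Require Import all_boot all_order all_classical.
From mathcomp Require Import topology sequences.

Local Open Scope classical_set_scope.

(** [D] itself is the dense set. For [u] in [D] the singletons [[set u n]] are open, and feeble
    compactness gives [x] and an infinite [I]. Missing a singleton means not containing its point,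
    so [u] along an increasing enumeration of [I] converges to [x]. *)

Lemma isolatedT_open (X : topologicalType) (x : X) :
  isolated [set: X] x -> open [set x].
Proof.
move=> [_ [V Vx]]; rewrite setIT => VE.
by rewrite openE => y ->; rewrite /interior -VE.
Qed.

Lemma infinite_nat_subsequence (I : set nat) : infinite_set I ->
  exists f : nat -> nat, increasing_seq f /\ forall n, I (f n).
Proof.
move=> I_infinite.
have [k|f [f_incr _ fI]] := infinite_increasing_seq_wf _ I_infinite 0.
  exact: sub_finite_set (finite_II k.+1).
by exists f.
Qed.

Lemma finite_set_near_oo (A : set nat) : finite_set A ->
  \forall n \near \oo, ~ A n.
Proof.
move=> /finite_seqP[s ->]; exists (\max_(i <- s) i).+1 => // n /= s_lt_n n_s.
by have := @leq_bigmax_seq _ s xpredT id n n_s isT; rewrite leqNgt s_lt_n.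
Qed.

(* [isolated [set: X] x]: x is isolated in the whole space X, not merely in D. *)
Theorem proposition3p4 (X : topologicalType) (D : set X)
    (hX : sequentially_feebly_compact X)
    (hdense : dense D)
    (hisol : forall x : X, D x -> isolated [set: X] x) :
  sequentially_pracompact X.
Proof.
exists D; split=> // u uD.
have [n|x [I [I_infinite Ix]]] := hX (fun n => [set u n]).
  by split; [exact: isolatedT_open (hisol (u n) (uD n))|exists (u n)].
have [f [f_incr fI]] := infinite_nat_subsequence I I_infinite.
exists f, x; split=> // V /Ix fin.
(* Injectivity of [f] keeps the exceptional set for [V] finite when pulled back along [f]. *)
have f_inj : {in f @^-1` [set n | I n /\ [set u n] `&` V = set0] &, injective f}.
  by move=> m n _ _; exact: increasing_seq_injective.
apply: filterS (finite_set_near_oo _ (finite_preimage f_inj fin)) => n /= nV.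
(* If [u (f n)] lay outside [V], then [f n] would be exceptional. *)
by apply: contrapT => ufnV; apply: nV; split=> //; apply/seteqP; split=> // y [->].
Qed.
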